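(* Let $M=-+\mathbf{1}$ be the maybe monad on $\mathbf{Set}$. Let $\Sigma^{\mathrm{s}}_{+\mathbf{1}}=\{\mathsf{a}:1,\ \bullet:0\}$ (a unary operation symbol and a constant) and $E^{\mathrm{s}}_{+\mathbf{1}}=\{\mathsf{a}\mathsf{a}x=\mathsf{a}x,\ \mathsf{a}\bullet=\bullet\}$. Then there is an isomorphism of categories $\mathbf{A}(\Sigma^{\mathrm{s}}_{+\mathbf{1}},E^{\mathrm{s}}_{+\mathbf{1}})\cong\mathrm{EM}_{\mathrm{s}}(-+\mathbf{1})$.
   Context: The maybe monad has functor $X\mapsto X+\mathbf{1}$ with $\mathbf{1}=\{\star\}$, unit $\eta_X=\mathsf{inl}:X\to X+\mathbf{1}$ and multiplication $\mu_X=[\mathrm{id}_{X+\mathbf{1}},\mathsf{inr}]:X+\mathbf{1}+\mathbf{1}\to X+\mathbf{1}$. For a monad $(M,\eta,\mu)$, an $M$-semialgebra is a pair $(X,x)$ with $x:MX\to X$ satisfying $x\circ Mx=x\circ\mu_X$ (no unit axiom). A homomorphism $(X,x)\to(Y,y)$ is $h:X\to Y$ with $h\circ x=y\circ Mh$. $\mathrm{EM}_{\mathrm{s}}(M)$ is the resulting category. For an algebraic theory $(\Sigma,E)$ (a signature of finitary operation symbols, written $f:n$ for arity $n$, and a set of equations between $\Sigma$-terms), $\mathbf{A}(\Sigma,E)$ is the category of $(\Sigma,E)$-algebras (sets with an operation $A^n\to A$ for each $f:n\in\Sigma$ satisfying all the equations in $E$) and operation-preserving maps. *)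

(* Defs.v *)
From mathcomp Require Import all_boot.
From mathcomp Require Import boolp.

Set Implicit Arguments.
Unset Strict Implicit.
Unset Printing Implicit Defensive.

Declare Scope cat_scope.
Local Open Scope cat_scope.

Reserved Notation "g \c f" (at level 50, left associativity).

Record category := Category {
  obj :> Type;
  hom : obj -> obj -> Type;
  idc : forall X, hom X X;
  compc : forall X Y Z, hom Y Z -> hom X Y -> hom X Z;
  compc1 : forall X Y (f : hom X Y), compc f (idc X) = f;
  comp1c : forall X Y (f : hom X Y), compc (idc Y) f = f;
  compcA : forall X Y Z W (h : hom Z W) (g : hom Y Z) (f : hom X Y),
    compc h (compc g f) = compc (compc h g) f }.

Arguments hom {c} X Y.
Arguments idc {c} X.
Notation "g \c f" := (compc g f) : cat_scope.

Record functor (C D : category) := Functor {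
  fobj :> C -> D;
  fmap : forall X Y, hom X Y -> hom (fobj X) (fobj Y);
  fmap1 : forall X, fmap (idc X) = idc (fobj X);
  fmapM : forall X Y Z (g : hom Y Z) (f : hom X Y),
    fmap (g \c f) = fmap g \c fmap f }.

Arguments fmap {C D} F {X Y} f : rename.

Definition idF (C : category) : functor C C :=
  @Functor C C id (fun X Y f => f) (fun=> erefl) (fun _ _ _ _ _ => erefl).

Section CompF.
Variables (C D E : category) (G : functor D E) (F : functor C D).

Fact compF1 (X : C) : fmap G (fmap F (idc X)) = idc (G (F X)).
Proof. by rewrite !fmap1. Qed.

Fact compFM (X Y Z : C) (g : hom Y Z) (f : hom X Y) :
  fmap G (fmap F (g \c f)) = fmap G (fmap F g) \c fmap G (fmap F f).
Proof. by rewrite !fmapM. Qed.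

Definition compF : functor C E :=
  @Functor C E (fun X => G (F X)) (fun X Y f => fmap G (fmap F f)) compF1 compFM.
End CompF.

(* Equality of functors is strict (Leibniz): this is isomorphism, not equivalence. *)
Definition isomorphic_categories (C D : category) : Prop :=
  exists (F : functor C D) (G : functor D C),
    compF G F = idF C /\ compF F G = idF D.

Record monad (C : category) := Monad {
  mfun :> functor C C;
  munit : forall X : C, hom X (mfun X);
  mmult : forall X : C, hom (mfun (mfun X)) (mfun X);
  munit_nat : forall (X Y : C) (f : hom X Y),
    munit Y \c f = fmap mfun f \c munit X;
  mmult_nat : forall (X Y : C) (f : hom X Y),
    mmult Y \c fmap mfun (fmap mfun f) = fmap mfun f \c mmult X;
  mmult_unitl : forall X : C, mmult X \c munit (mfun X) = idc (mfun X);
  mmult_unitr : forall X : C, mmult X \c fmap mfun (munit X) = idc (mfun X);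
  mmultA : forall X : C, mmult X \c fmap mfun (mmult X) = mmult X \c mmult (mfun X) }.

Section Semialgebras.
Variables (C : category) (M : monad C).

(* Algebras for the monad without the unit axiom [x \c munit M X = idc X]. *)
Record semialgebra := Semialgebra {
  sa_obj : C;
  sa_str : hom (M sa_obj) sa_obj;
  sa_law : sa_str \c fmap M sa_str = sa_str \c mmult M sa_obj }.

Definition sa_morph (A B : semialgebra) (h : hom (sa_obj A) (sa_obj B)) : Prop :=
  h \c sa_str A = sa_str B \c fmap M h.

Definition sa_hom (A B : semialgebra) := {h | @sa_morph A B h}.

Fact sa_morph1 (A : semialgebra) : sa_morph (idc (sa_obj A) : hom _ (sa_obj A)).
Proof. by rewrite /sa_morph fmap1 comp1c compc1. Qed.

Fact sa_morphM (A B D : semialgebra) (g : sa_hom B D) (f : sa_hom A B) :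
  @sa_morph A D (sval g \c sval f).
Proof.
rewrite /sa_morph fmapM -compcA (svalP f) compcA (svalP g).
by rewrite compcA.
Qed.

Definition sa_id (A : semialgebra) : sa_hom A A := exist _ _ (sa_morph1 A).
Definition sa_comp (A B D : semialgebra) (g : sa_hom B D) (f : sa_hom A B) :
  sa_hom A D := exist _ _ (sa_morphM g f).

Fact sa_compc1 (A B : semialgebra) (f : sa_hom A B) : sa_comp f (sa_id A) = f.
Proof. by case: f => f fP; apply: eq_exist; apply: compc1. Qed.

Fact sa_comp1c (A B : semialgebra) (f : sa_hom A B) : sa_comp (sa_id B) f = f.
Proof. by case: f => f fP; apply: eq_exist; apply: comp1c. Qed.

Fact sa_compcA (A B D E : semialgebra)
    (h : sa_hom D E) (g : sa_hom B D) (f : sa_hom A B) :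
  sa_comp h (sa_comp g f) = sa_comp (sa_comp h g) f.
Proof. by apply: eq_exist; apply: compcA. Qed.

Definition EMs : category :=
  @Category semialgebra sa_hom sa_id sa_comp sa_compc1 sa_comp1c sa_compcA.
End Semialgebras.

Definition SetCat : category :=
  @Category Type (fun X Y => X -> Y) (fun X x => x) (fun X Y Z g f x => g (f x))
    (fun _ _ _ => erefl) (fun _ _ _ => erefl) (fun _ _ _ _ _ _ _ => erefl).

Definition maybe_map (X Y : Type) (f : X -> Y) (t : X + unit) : Y + unit :=
  match t with inl x => inl (f x) | inr u => inr u end.

Definition maybe_mult (X : Type) (t : (X + unit) + unit) : X + unit :=
  match t with inl s => s | inr u => inr u end.

Fact maybe_map1 (X : SetCat) : @maybe_map X X (idc X) = @idc SetCat (X + unit)%type.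
Proof. by apply/funext => -[]. Qed.

Fact maybe_mapM (X Y Z : SetCat) (g : hom Y Z) (f : hom X Y) :
  @maybe_map X Z (g \c f) = (@maybe_map Y Z g : @hom SetCat _ _) \c @maybe_map X Y f.
Proof. by apply/funext => -[]. Qed.

Definition maybe_functor : functor SetCat SetCat :=
  @Functor SetCat SetCat (fun X => (X + unit)%type) maybe_map maybe_map1 maybe_mapM.

Definition maybe_monad : monad SetCat.
Proof.
refine (@Monad SetCat maybe_functor (fun X => inl) maybe_mult _ _ _ _ _).
- by [].
- by move=> X Y f; apply/funext => -[[]|].
- by [].
- by move=> X; apply/funext => -[].
- by move=> X; apply/funext => -[[]|].
Defined.

Record signature := Signature { op : Type; arity : op -> nat }.

Inductive term (S : signature) (V : Type) : Type :=
| Var of V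
| App (f : op S) of ('I_(arity f) -> term S V).

Arguments Var {S V} x.
Arguments App {S V} f args.

(* Equations are written over the countable stock of variables [nat]. *)
Record theory := Theory {
  tsig :> signature;
  teq : term tsig nat -> term tsig nat -> Prop }.

Fixpoint eval (S : signature) (V A : Type)
    (o : forall f : op S, ('I_(arity f) -> A) -> A) (v : V -> A) (t : term S V) : A :=
  match t with
  | Var x => v x
  | App f args => o f (fun i => eval o v (args i))
  end.

Section Algebras.
Variable T : theory.

Record algebra := Algebra {
  al_carrier : Type;
  al_op : forall f : op T, ('I_(arity f) -> al_carrier) -> al_carrier;
  al_law : forall s t, teq s t ->
    forall v : nat -> al_carrier, eval al_op v s = eval al_op v t }.

Arguments al_op : clear implicits.

Definition al_morph (A B : algebra) (h : al_carrier A -> al_carrier B) : Prop :=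
  forall (f : op T) (x : 'I_(arity f) -> al_carrier A),
    h (al_op A f x) = al_op B f (fun i => h (x i)).

Definition al_hom (A B : algebra) := {h | @al_morph A B h}.

Fact al_morph1 (A : algebra) : @al_morph A A id.
Proof. by []. Qed.

Fact al_morphM (A B D : algebra) (g : al_hom B D) (f : al_hom A B) :
  @al_morph A D (fun x => sval g (sval f x)).
Proof. by move=> o x; rewrite (svalP f) (svalP g). Qed.

Definition al_id (A : algebra) : al_hom A A := exist _ _ (@al_morph1 A).
Definition al_comp (A B D : algebra) (g : al_hom B D) (f : al_hom A B) :
  al_hom A D := exist _ _ (al_morphM g f).

Fact al_compc1 (A B : algebra) (f : al_hom A B) : al_comp f (al_id A) = f.
Proof. by case: f => f fP; apply: eq_exist. Qed.

Fact al_comp1c (A B : algebra) (f : al_hom A B) : al_comp (al_id B) f = f.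
Proof. by case: f => f fP; apply: eq_exist. Qed.

Fact al_compcA (A B D E : algebra)
    (h : al_hom D E) (g : al_hom B D) (f : al_hom A B) :
  al_comp h (al_comp g f) = al_comp (al_comp h g) f.
Proof. by apply: eq_exist. Qed.

Definition Alg : category :=
  @Category algebra al_hom al_id al_comp al_compc1 al_comp1c al_compcA.
End Algebras.

Arguments al_op {T} A f x : rename.

Inductive maybe_op := op_a | op_bullet.

Definition maybe_sig : signature :=
  @Signature maybe_op (fun f => match f with op_a => 1 | op_bullet => 0 end).

Definition term_a (t : term maybe_sig nat) : term maybe_sig nat :=
  @App maybe_sig nat op_a (tnth [tuple t]).

Definition term_bullet : term maybe_sig nat :=
  @App maybe_sig nat op_bullet (tnth [tuple]).

Inductive maybe_semi_eq : term maybe_sig nat -> term maybe_sig nat -> Prop :=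
| eq_a_idem : maybe_semi_eq (term_a (term_a (Var 0))) (term_a (Var 0))
| eq_a_bullet : maybe_semi_eq (term_a term_bullet) term_bullet.

Definition maybe_semi_theory : theory := @Theory maybe_sig maybe_semi_eq.

(* Main.v *)
From mathcomp Require Import all_boot.
From mathcomp Require Import boolp.
Require Import Defs.

Set Implicit Arguments.
Unset Strict Implicit.
Unset Printing Implicit Defensive.

Local Open Scope cat_scope.

(** A map [x : X + 1 -> X] is the same thing as a unary operation [a] together
with a point [b]. Evaluated on the three summands of [X + 1 + 1], the
semialgebra law says [a (a y) = a y], [a b = b] and [b = b], so it is exactly
the equational theory; likewise homomorphisms are the same maps. The resulting
bijections keep carriers and underlying maps fixed, so that the two composite
functors are strictly the identities. *)

Definition hom_of_eq (C : category) (X Y : C) (p : X = Y) : hom X Y :=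
  match p with erefl => idc X end.

(* Commuting with [hom_of_eq] avoids transporting morphisms along [e]. *)
Lemma functor_ext (C D : category) (F G : functor C D)
    (e : forall X, F X = G X) :
  (forall X Y (f : hom X Y),
     hom_of_eq (e Y) \c fmap F f = fmap G f \c hom_of_eq (e X)) ->
  F = G.
Proof.
case: F G e => [F0 F1 F1P F2P] [G0 G1 G1P G2P] /= e.
have /funext E : F0 =1 G0 := e.
case: _ / E in G1 G1P G2P e * => nat_e.
have E1 : F1 = G1.
  apply: functional_extensionality_dep => X.
  apply: functional_extensionality_dep => Y.
  apply/funext => f; move: (nat_e X Y f).
  (* With the object maps identified, [e X] and [e Y] are loops; proof irrelevance makes them
     [erefl], so both [hom_of_eq] become identities. *)
  rewrite (Prop_irrelevance (e X) erefl) (Prop_irrelevance (e Y) erefl) /=.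
  by rewrite comp1c compc1.
case: _ / E1 in G1P G2P nat_e *.
by rewrite (Prop_irrelevance G1P F1P) (Prop_irrelevance G2P F2P).
Qed.

Lemma algebra_ext (T : theory) (A : Type)
    (o o' : forall f : op T, ('I_(arity f) -> A) -> A) l l' :
  o = o' -> @Algebra T A o l = @Algebra T A o' l'.
Proof. by move=> E; case: _ / E in l' *; rewrite (Prop_irrelevance l l'). Qed.

(** Both algebras have carrier [A] by conversion, so the underlying map can be compared with [id]
    although [p] is opaque. Once [o] and [o'] are identified, [p] is a loop and proof irrelevance
    applies. *)
Lemma hom_of_eq_alg (T : theory) (A : Type)
    (o o' : forall f : op T, ('I_(arity f) -> A) -> A) l l'
    (p : @Algebra T A o l = @Algebra T A o' l') :
  o = o' -> sval (@hom_of_eq (Alg T) _ _ p) = id.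
Proof.
move=> E; case: _ / E in l' p *; move: p; rewrite (Prop_irrelevance l' l) => p.
by rewrite (Prop_irrelevance p erefl).
Qed.

Lemma semialgebra_ext (C : category) (M : monad C) (A : C)
    (x x' : hom (M A) A) l l' :
  x = x' -> @Semialgebra C M A x l = @Semialgebra C M A x' l'.
Proof. by move=> E; case: _ / E in l' *; rewrite (Prop_irrelevance l l'). Qed.

Lemma hom_of_eq_EMs (C : category) (M : monad C) (A : C)
    (x x' : hom (M A) A) l l'
    (p : @Semialgebra C M A x l = @Semialgebra C M A x' l') :
  x = x' -> sval (@hom_of_eq (EMs M) _ _ p) = idc A.
Proof.
move=> E; case: _ / E in l' p *; move: p; rewrite (Prop_irrelevance l' l) => p.
by rewrite (Prop_irrelevance p erefl).
Qed.

Definition str_of_op (A : Type)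
    (o : forall f : op maybe_sig, ('I_(arity f) -> A) -> A) (t : A + unit) : A :=
  match t with
  | inl y => o op_a (fun=> y)
  | inr _ => o op_bullet (fun i : 'I_0 => False_rect A (notF (valP i)))
  end.

Definition op_of_str (A : Type) (x : A + unit -> A) (f : op maybe_sig) :
    ('I_(arity f) -> A) -> A :=
  match f with
  | op_a => fun y => x (inl (y ord0))
  | op_bullet => fun=> x (inr tt)
  end.

Lemma fun_ord1E (A : Type) (f : 'I_1 -> A) : f = fun=> f ord0.
Proof. by apply/funext => i; rewrite ord1. Qed.

(** Any two maps out of ['I_0] agree, but only by extensionality; this lets the arbitrary empty
    tuple [y] be exchanged for the one chosen in [str_of_op]. *)
Lemma str_of_op_bullet (A : Type)
    (o : forall f : op maybe_sig, ('I_(arity f) -> A) -> A) y :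
  o op_bullet y = str_of_op o (inr tt).
Proof. by congr (o op_bullet); apply/funext => -[]. Qed.

Lemma str_of_opK (A : Type) : cancel (@str_of_op A) (@op_of_str A).
Proof.
move=> o; apply: functional_extensionality_dep => -[]; apply/funext => y /=.
  by rewrite -fun_ord1E.
by rewrite (str_of_op_bullet o y).
Qed.

Lemma op_of_strK (A : Type) : cancel (@op_of_str A) (@str_of_op A).
Proof. by move=> x; apply/funext => -[|[]]. Qed.

Lemma semialgebra_of_algebra_law (A : algebra maybe_semi_theory) :
  let x : @hom SetCat (al_carrier A + unit)%type (al_carrier A) :=
    str_of_op (al_op A) in
  x \c fmap maybe_monad x = x \c mmult maybe_monad (al_carrier A).
Proof.
case: A => A o l x; apply/funext => -[[y|[]]|[]] //=.
  (* The summand [inl (inl y)] is idempotence at [y]. Evaluation applies [o op_a] to functions built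
     with [tnth], which [fun_ord1E] turns into the constant functions used by [str_of_op]. *)
  have /= := l _ _ eq_a_idem (fun=> y).
  rewrite [X in o op_a X = _]fun_ord1E [X in _ = o op_a X]fun_ord1E /=.
  by rewrite [X in o op_a (fun=> o op_a X) = _]fun_ord1E.
(* The equation is closed, so any valuation serves; the constant itself provides an element of the
   carrier. *)
have /= := l _ _ eq_a_bullet (fun=> x (inr tt)).
by rewrite [X in o op_a X = _]fun_ord1E /= (str_of_op_bullet o).
Qed.

Definition semialgebra_of_algebra (A : Alg maybe_semi_theory) :
    EMs maybe_monad :=
  @Semialgebra SetCat maybe_monad _ _ (semialgebra_of_algebra_law A).

Lemma algebra_of_semialgebra_law (X : semialgebra maybe_monad)
    (s t : term maybe_sig nat) :
  maybe_semi_eq s t -> forall v : nat -> sa_obj X,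
  eval (op_of_str (sa_str X)) v s = eval (op_of_str (sa_str X)) v t.
Proof.
case: X => X x l.
have E u : x (maybe_map x u) = x (maybe_mult u) by exact: (f_equal (@^~ u) l).
(* Each equation is the law at one point of [X + 1 + 1], up to computing [tnth] at [ord0]. *)
by case=> v; [exact: (E (inl (inl (v 0)))) | exact: (E (inl (inr tt)))].
Qed.

Definition algebra_of_semialgebra (X : EMs maybe_monad) :
    Alg maybe_semi_theory :=
  @Algebra maybe_semi_theory _ _ (@algebra_of_semialgebra_law X).

Lemma sa_morph_of_al_morph (A B : Alg maybe_semi_theory) (h : hom A B) :
  @sa_morph _ _ (semialgebra_of_algebra A) (semialgebra_of_algebra B) (sval h).
Proof.
apply/funext => -[y|[]] /=; rewrite (svalP h) //=.
(* Composing the empty tuple of [A] with [h] gives an empty tuple of [B], though not literally the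
   chosen one. *)
exact: (str_of_op_bullet (al_op B)).
Qed.

Lemma al_morph_of_sa_morph (X Y : EMs maybe_monad) (h : hom X Y) :
  @al_morph _ (algebra_of_semialgebra X) (algebra_of_semialgebra Y) (sval h).
Proof.
have E t : sval h (sa_str X t) = sa_str Y (maybe_map (sval h) t).
  exact: (f_equal (@^~ t) (svalP h)).
by case=> y; [exact: (E (inl (y ord0))) | exact: (E (inr tt))].
Qed.

Definition semialgebra_functor :
  functor (Alg maybe_semi_theory) (EMs maybe_monad).
Proof.
refine (@Functor (Alg maybe_semi_theory) (EMs maybe_monad)
  semialgebra_of_algebra
  (fun A B h => exist _ (sval h) (sa_morph_of_al_morph h)) _ _).
- by move=> A; apply: eq_exist.
- by move=> A B D g f; apply: eq_exist.
Defined.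

Definition algebra_functor :
  functor (EMs maybe_monad) (Alg maybe_semi_theory).
Proof.
refine (@Functor (EMs maybe_monad) (Alg maybe_semi_theory)
  algebra_of_semialgebra
  (fun X Y h => exist _ (sval h) (al_morph_of_sa_morph h)) _ _).
- by move=> X; apply: eq_exist.
- by move=> X Y Z g f; apply: eq_exist.
Defined.

Lemma semialgebra_of_algebraK :
  cancel semialgebra_of_algebra algebra_of_semialgebra.
Proof. by case=> A o l; apply: algebra_ext; apply: str_of_opK. Qed.

Lemma algebra_of_semialgebraK :
  cancel algebra_of_semialgebra semialgebra_of_algebra.
Proof. by case=> X x l; apply: semialgebra_ext; apply: op_of_strK. Qed.

Theorem theorem5p1 :
  isomorphic_categories (Alg maybe_semi_theory) (EMs maybe_monad).
Proof.
exists semialgebra_functor, algebra_functor; split.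
- apply: (@functor_ext _ _ (compF algebra_functor semialgebra_functor)
    (idF _) semialgebra_of_algebraK) => A B f.
  (* The round trip alters only the operations, never the carrier, so the comparison morphism is the
     identity map and the naturality square collapses to [f] on both sides. *)
  have idE (D : Alg maybe_semi_theory) :
      sval (hom_of_eq (semialgebra_of_algebraK D)) = id.
    by case: D => D o l; apply: hom_of_eq_alg; apply: str_of_opK.
  by apply: eq_exist; rewrite /= !idE.
- apply: (@functor_ext _ _ (compF semialgebra_functor algebra_functor)
    (idF _) algebra_of_semialgebraK) => X Y f.
  have idE (Z : EMs maybe_monad) :
      sval (hom_of_eq (algebra_of_semialgebraK Z)) = id.
    by case: Z => Z z l; apply: hom_of_eq_EMs; apply: op_of_strK.
  by apply: eq_exist; rewrite /= !idE.
Qed.
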